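(* Let $q$ be a power of an odd prime with $q\equiv3\pmod4$, $d=4k+3$ with $k$ a positive integer, $P=\{(x_1,\dots,x_d)\in\mathbb F_q^d: x_d=x_1^2+\cdots+x_{d-1}^2\}$, and $A\subset P$. Then \[E(A)\ll \frac{|A|^3}{q}+q^{\frac{d-2}{2}}|A|^2.\]
   Context: $E(A)=|\{(a,b,c,e)\in A^4: a+b=c+e\}|$ is the additive energy. $X\ll Y$ means $X\le CY$ with $C$ an absolute constant independent of $q$ and $A$. *)

(* Defs.v *)
From HB Require Import structures.
From mathcomp Require Import all_boot all_order all_algebra all_field.
From mathcomp Require Import reals.
Set Implicit Arguments. Unset Strict Implicit. Unset Printing Implicit Defensive.
Import Order.TTheory GRing.Theory Num.Theory.
Local Open Scope ring_scope.

Definition paraboloid (F : finFieldType) (n : nat) : {set 'rV[F]_n.+1} :=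
  [set x : 'rV[F]_n.+1 |
     x 0 ord_max == \sum_(i < n) (x 0 (widen_ord (leqnSn n) i)) ^+ 2].

Definition add_energy (V : finZmodType) (A : {set V}) : nat :=
  #|[set t : V * V * V * V |
      [&& t.1.1.1 \in A, t.1.1.2 \in A, t.1.2 \in A, t.2 \in A &
          t.1.1.1 + t.1.1.2 == t.1.2 + t.2]]|.

(* Main.v *)
Require Import Defs.
From HB Require Import structures.
From mathcomp Require Import all_boot all_order all_algebra all_field.
From mathcomp Require Import reals.
From mathcomp Require Import zify ring lra.
Set Implicit Arguments. Unset Strict Implicit. Unset Printing Implicit Defensive.
Import Order.TTheory GRing.Theory Num.Theory.
Local Open Scope ring_scope.

(** Put [n = d - 1 = 2m] with [m = 2k + 1] odd. Projecting [A] to a set [B] in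
    [F^n], the energy is at most the number of triples [x, y, z] of [B] with
    [(x - z).(y - z) = 0].

    If the leg [x - z] is anisotropic, [z] is the foot of the perpendicular from
    [x] to the hyperplane through [z] normal to the leg, so a hyperplane arises
    from at most [|B|] pairs [(x, z)]. Cauchy-Schwarz against the variance of
    [|B /\ H|] over the hyperplanes [H] yields [|B|^3/q + q^((n-1)/2) |B|^2].

    If both legs are isotropic, so is [x - y], and [x, y] lie in the set [B_z] of
    points at distance zero from [z]. Since [-1] is not a square and [m] is odd,
    the form is elliptic, and a set [S] has at most [|S|^2/q + q^(m-1) |S|]
    pairs at distance zero; this is applied to each [B_z]. *)

(** * Squares and sums of two squares for [q = 3 mod 4] *)

Section SumsOfTwoSquares.
Variable F : finFieldType.
Hypothesis q3 : (#|F| %% 4 = 3)%N.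

(** The translation [x -> x + 1] permutes [K], so the sum of all elements is unchanged when [|K|] is
    added to it. *)
Lemma natr_card_finField (K : finFieldType) : #|K|%:R = 0 :> K.
Proof.
have h : \sum_(x : K) x = \sum_(x : K) (x + 1) by apply: (reindex_inj (addIr 1)).
move: h; rewrite big_split /= sumr_const => /eqP.
by rewrite -subr_eq0 opprD addNKr oppr_eq0 => /eqP.
Qed.

Lemma two_neq0 : 2%:R != 0 :> F.
Proof.
apply/eqP => h2; have := natr_card_finField F.
have -> : #|F| = (2 * (#|F| %/ 2) + 1)%N by lia.
by rewrite natrD natrM h2 mul0r add0r => /eqP; rewrite oner_eq0.
Qed.

(** As [(q - 1)/2] is odd, [x^2 = -1] would give [x^q = -x], against [x^q = x]. *)
Lemma sqr_neq_opp1 (x : F) : x ^+ 2 != -1.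
Proof.
apply/eqP => hx; have x0 : x != 0.
  by apply/eqP => x0; move/eqP: hx; rewrite x0 expr0n /= eq_sym oppr_eq0 oner_eq0.
have := expf_card x.
have -> : #|F| = (2 * (2 * (#|F| %/ 4) + 1) + 1)%N by lia.
rewrite addn1 exprS exprM hx -signr_odd oddD oddM /= expr1 mulrN1 => /eqP.
by rewrite -subr_eq0 -opprD oppr_eq0 -mulr2n -mulr_natl mulf_eq0 (negPf two_neq0) (negPf x0).
Qed.

(** The witness is [r = x^((q+1)/4)]: then [r^4 = x^(q+1) = x^2], so [r^2] is [x] or [-x]. *)
Lemma sqr_or_opp_sqr (x : F) : exists r, x = r ^+ 2 \/ x = - r ^+ 2.
Proof.
exists (x ^+ (#|F| %/ 4).+1).
suff: (x ^+ (#|F| %/ 4).+1 ^+ 2) ^+ 2 == x ^+ 2.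
  by rewrite eqf_sqr => /orP [] /eqP ->; [left | right; rewrite opprK].
rewrite -!exprM; apply/eqP.
have -> : ((#|F| %/ 4).+1 * (2 * 2) = #|F| + 1)%N by lia.
by rewrite exprD expf_card expr1 expr2.
Qed.

(** Otherwise a sum of two squares is never minus a nonzero square, so the squares are closed under
    addition. Then every multiple of 1 is a square, among them [q - 1 = -1]. *)
Lemma opp1_sum_squares : exists a b : F, a ^+ 2 + b ^+ 2 = -1.
Proof.
suff /existsP [a /existsP [b /eqP h]] :
    [exists a : F, [exists b : F, a ^+ 2 + b ^+ 2 == -1]] by exists a, b.
apply: contraT; rewrite negb_exists => /forallP none.
have add_sq (a b : F) : exists c, a ^+ 2 + b ^+ 2 = c ^+ 2.
  have [c [hc|hc]] := sqr_or_opp_sqr (a ^+ 2 + b ^+ 2); first by exists c.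
  have [c0|c0] := eqVneq c 0; first by exists 0; rewrite hc c0 expr0n oppr0.
  have := none (a / c); rewrite negb_exists => /forallP /(_ (b / c)).
  by rewrite !expr_div_n -mulrDl hc mulNr divff ?eqxx // expf_neq0.
have nat_sq n : exists c : F, n%:R = c ^+ 2.
  elim: n => [|n [c hc]]; first by exists 0; rewrite expr0n.
  by have [e he] := add_sq c 1; exists e; rewrite -he -hc expr1n natr1.
have [c hc] := nat_sq #|F|.-1; have := sqr_neq_opp1 c.
rewrite -hc -subr_eq0 opprK natr1 prednK ?natr_card_finField ?eqxx //.
by lia.
Qed.

Lemma sum_two_squares (e : F) : exists a b, a ^+ 2 + b ^+ 2 = e.
Proof.
have [r [->|->]] := sqr_or_opp_sqr e; first by exists r, 0; rewrite expr0n addr0.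
have [a [b h]] := opp1_sum_squares.
by exists (a * r), (b * r); rewrite !exprMn -mulrDl h mulN1r.
Qed.

Lemma add_sqr_eq0 (s t : F) : (s ^+ 2 + t ^+ 2 == 0) = (s == 0) && (t == 0).
Proof.
apply/idP/andP => [h|[/eqP -> /eqP ->]]; last by rewrite expr0n addr0.
have [t0|t0] := eqVneq t 0.
  by move: h; rewrite t0 expr0n addr0 sqrf_eq0 => ->.
have := sqr_neq_opp1 (s / t); rewrite expr_div_n => /negP []; move: h.
by rewrite addr_eq0 => /eqP ->; rewrite mulNr divff // expf_neq0.
Qed.

Definition circle (e : F) := [set p : F * F | p.1 ^+ 2 + p.2 ^+ 2 == e].

(* Multiplying by [a + b sqrt(-1)] scales the norm form by [a^2 + b^2]. *)
Lemma card_circle_leq (e f : F) : f != 0 -> (#|circle e| <= #|circle (f * e)%R|)%N.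
Proof.
move=> f0; have [a [b hab]] := sum_two_squares f.
pose g (p : F * F) := (a * p.1 - b * p.2, a * p.2 + b * p.1).
pose g' (p : F * F) := (f^-1 * (a * p.1 + b * p.2), f^-1 * (a * p.2 - b * p.1)).
have gK : cancel g g'.
  by move=> [s t]; rewrite /g' /g /=; congr pair; rewrite -hab in f0 *; field.
rewrite -(card_imset _ (can_inj gK)) subset_leq_card //.
apply/subsetP => _ /imsetP [[s t] + ->]; rewrite !inE /= => /eqP <-.
by apply/eqP; rewrite -hab; ring.
Qed.

(** The circles of nonzero radius have a common size [c], and that of radius 0 is a point.
    Partitioning the plane gives [q^2 = 1 + (q - 1) c]. *)
Lemma card_circle (e : F) : e != 0 -> #|circle e| = #|F|.+1.
Proof.
have const f : f != 0 -> #|circle f| = #|circle 1|.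
  move=> f0; apply/eqP; rewrite eqn_leq.
  have := card_circle_leq f (invr_neq0 f0); rewrite mulVf // => ->.
  by have := card_circle_leq 1 f0; rewrite mulr1 => ->.
have c0 : #|circle 0| = 1%N.
  rewrite -(cards1 (0 : F * F)); apply: eq_card => -[s t].
  by rewrite !inE /= add_sqr_eq0.
move=> e0; rewrite const //.
have tot : (\sum_(f : F) #|circle f| = #|F| * #|F|)%N.
  rewrite -card_prod -sum1_card (partition_big (fun p => p.1 ^+ 2 + p.2 ^+ 2) xpredT) //=.
  by apply: eq_bigr => f _; rewrite -sum1_card; apply: eq_bigl => p; rewrite inE.
move: tot; rewrite (bigD1 0) //= c0 (eq_bigr (fun _ => #|circle 1|)) // sum_nat_const.
have -> : #|[pred i : F | i != 0]| = #|F|.-1 by rewrite cardC1.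
have q1 : (2 < #|F|)%N by lia.
by move: #|circle 1| #|F| q1 => c q; nia.
Qed.

Lemma sum_circle (R : numDomainType) (e : F) :
  \sum_(s : F) \sum_(t : F) (s ^+ 2 + t ^+ 2 == e)%:R
    = #|F|%:R + 1 - #|F|%:R * (e == 0)%:R :> R.
Proof.
rewrite pair_big /= -natr_sum.
have -> : (\sum_(p : F * F) (p.1 ^+ 2 + p.2 ^+ 2 == e)%R = #|circle e|)%N.
  by rewrite -sum1_card [RHS]big_mkcond; apply: eq_bigr => p _; rewrite inE; case: eqP.
have [->|e0] := eqVneq e 0; last by rewrite card_circle // mulr0 subr0 natr1.
rewrite mulr1 addrAC subrr add0r -[RHS]/(1%:R); congr _%:R.
rewrite -(cards1 (0 : F * F)); apply: eq_card => -[s t].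
by rewrite !inE /= add_sqr_eq0.
Qed.

End SumsOfTwoSquares.

(** * The standard dot product on row vectors *)

Definition dot (F : finFieldType) (n : nat) (u v : 'rV[F]_n) : F :=
  \sum_i u 0 i * v 0 i.

Section Dot.
Variables (F : finFieldType) (n : nat).
Implicit Types u v w : 'rV[F]_n.

Lemma dotC u v : dot u v = dot v u.
Proof. by apply: eq_bigr => i _; rewrite mulrC. Qed.

Lemma dotDl u v w : dot (u + v) w = dot u w + dot v w.
Proof. by rewrite -big_split; apply: eq_bigr => i _; rewrite mxE mulrDl. Qed.

Lemma dotZl a u w : dot (a *: u) w = a * dot u w.
Proof. by rewrite mulr_sumr; apply: eq_bigr => i _; rewrite mxE mulrA. Qed.

Lemma dotNl u w : dot (- u) w = - dot u w.
Proof. by rewrite -scaleN1r dotZl mulN1r. Qed.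

Lemma dotDr u v w : dot w (u + v) = dot w u + dot w v.
Proof. by rewrite dotC dotDl !(dotC w). Qed.

Lemma dotZr a u w : dot w (a *: u) = a * dot w u.
Proof. by rewrite dotC dotZl dotC. Qed.

Lemma dotNr u w : dot w (- u) = - dot w u.
Proof. by rewrite dotC dotNl dotC. Qed.

Lemma dot0l w : dot 0 w = 0.
Proof. by rewrite -(scale0r 0) dotZl mul0r. Qed.

Lemma dot0r w : dot w 0 = 0.
Proof. by rewrite dotC dot0l. Qed.

Definition dotE := (dotDl, dotDr, dotZl, dotZr, dotNl, dotNr, dot0l, dot0r).

Lemma dot_eq1 v : v != 0 -> exists w, dot w v = 1.
Proof.
move=> v0; have /rV0Pn [i vi] := v0.
exists ((v 0 i)^-1 *: delta_mx 0 i); rewrite dotZl (_ : dot _ _ = v 0 i) ?mulVf //.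
rewrite /dot (bigD1 i) //= mxE !eqxx mul1r big1 ?addr0 // => j ji.
by rewrite mxE (negPf ji) andbF mul0r.
Qed.

End Dot.

(** * Sums of indicator functions *)

Section IndicatorSums.
Variables (R : numDomainType) (T : finType).

Lemma sum_indicator (a : T) (f : T -> R) : \sum_x (a == x)%:R * f x = f a.
Proof.
rewrite (bigD1 a) //= eqxx mul1r big1 ?addr0 // => x xa.
by rewrite eq_sym (negPf xa) mul0r.
Qed.

Lemma sum_eq_indicator (a : T) : \sum_x (a == x)%:R = 1 :> R.
Proof. by rewrite -[RHS](sum_indicator a (fun=> 1)); apply: eq_bigr => x _; rewrite mulr1. Qed.

Lemma sum_const (a : R) : \sum_(x : T) a = #|T|%:R * a.
Proof. by rewrite sumr_const mulr_natl. Qed.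

Lemma sum_indicator_le1 (P : pred T) :
  (forall x y, P x -> P y -> x = y) -> \sum_x (P x)%:R <= 1 :> R.
Proof.
move=> uni; have -> : \sum_x (P x)%:R = #|P|%:R :> R.
  by rewrite -sum1_card natr_sum [RHS]big_mkcond; apply: eq_bigr => x _;
  rewrite unfold_in; case: (P x).
rewrite -[leRHS]/(1%:R) ler_nat.
by apply/card_le1_eqP => x y Px Py; apply: uni; rewrite -topredE in Px Py.
Qed.

End IndicatorSums.

(** * Counting isotropic vectors in the space and in its hyperplanes *)

Section IsotropicCounts.
Variables (R : realFieldType) (F : finFieldType).
Hypothesis q3 : (#|F| %% 4 = 3)%N.
Local Notation q := (#|F|%:R : R).

Lemma card_gt0r : 0 < q.
Proof. by rewrite ltr0n; apply/card_gt0P; exists 0. Qed.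

Lemma card_neq0r : q != 0.
Proof. by rewrite gt_eqF // card_gt0r. Qed.

(** Translating [u] by multiples of a [w] with [w . v = 1] moves between the level sets of [u . v],
    so all [q] of them have equal size. *)
Lemma sum_linear_eq n (v : 'rV[F]_n) c :
  v != 0 -> \sum_(u : 'rV[F]_n) (dot u v == c)%:R = q ^+ n / q.
Proof.
move=> v0; have [w wv] := dot_eq1 v0.
have const b : \sum_(u : 'rV[F]_n) (dot u v == b)%:R
    = \sum_(u : 'rV[F]_n) (dot u v == c)%:R :> R.
  rewrite (reindex_inj (addIr ((b - c) *: w))) /=; apply: eq_bigr => u _.
  by rewrite !dotE wv mulr1 -subr_eq0 -[in RHS]subr_eq0; do 2!congr (_ _); congr (_ == 0); ring.
apply: (mulIf card_neq0r); rewrite divfK ?card_neq0r // mulr_natr -sumr_const.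
rewrite -(eq_bigr _ (fun b _ => const b)) exchange_big /=.
under eq_bigr => u _ do rewrite sum_eq_indicator.
by rewrite sum_const mulr1 card_mx mul1n natrX.
Qed.

Lemma sum_rV_cons n (f : 'rV[F]_(1 + n) -> R) :
  \sum_x f x = \sum_(t : F) \sum_(y : 'rV[F]_n) f (row_mx t%:M y).
Proof.
rewrite pair_big /= (reindex (fun p : F * 'rV[F]_n => row_mx p.1%:M p.2)) //=.
exists (fun x : 'rV[F]_(1 + n) => (lsubmx x 0 0, rsubmx x)) => [[t y] _|x _] /=.
  by rewrite row_mxKl row_mxKr mxE eqxx.
by rewrite -mx11_scalar hsubmxK.
Qed.

Lemma dot_cons n (t : F) (y : 'rV[F]_n) :
  dot (row_mx t%:M y) (row_mx t%:M y) = t ^+ 2 + dot y y.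
Proof.
rewrite /dot big_split_ord big_ord1 /= row_mxEl mxE eqxx expr2; congr (_ + _).
by apply: eq_bigr => i _; rewrite row_mxEr.
Qed.

(** Induction on [m], splitting off two coordinates [s, t]. As [s^2 + t^2] is anisotropic,
    [sum_circle] makes each such plane multiply the deviation from the mean by [-q]. *)
Lemma sum_norm_eq m (c : F) :
  \sum_(x : 'rV[F]_(m.*2)) (dot x x == c)%:R
    = q ^+ m.*2 / q + (- q) ^+ m * ((c == 0)%:R - q^-1) :> R.
Proof.
elim: m c => [|m IHm] c.
  rewrite !expr0 !mul1r addrC subrK (eq_bigr (fun=> (c == 0)%:R)) => [|x _]; last first.
    by rewrite /dot big_ord0 eq_sym.
  by rewrite sumr_const card_mx muln0 expn0.
rewrite -[m.+1.*2]/(1 + (1 + m.*2))%N sum_rV_cons.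
under eq_bigr => s _.
  rewrite sum_rV_cons; under eq_bigr => t _.
    under eq_bigr => y _ do rewrite !dot_cons addrA [_ + dot y y]addrC eq_sym -subr_eq eq_sym.
    over.
  over.
have -> : \sum_(s : F) \sum_(t : F) \sum_(y : 'rV[F]_m.*2)
      (dot y y == c - (s ^+ 2 + t ^+ 2))%:R
    = \sum_(s : F) \sum_(t : F) (q ^+ m.*2 / q - (- q) ^+ m / q
       + (- q) ^+ m * (s ^+ 2 + t ^+ 2 == c)%:R).
  apply: eq_bigr => s _; apply: eq_bigr => t _.
  by rewrite IHm subr_eq0 (eq_sym c); ring.
under eq_bigr => s _ do rewrite big_split /= sum_const -mulr_sumr.
rewrite big_split /= !sum_const -mulr_sumr sum_circle //.
rewrite !add1n !exprS; have := card_neq0r; set x := _%:R : R => x0.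
by move: (x ^+ m.*2) ((- x) ^+ m) => Q P; field.
Qed.

(* For [v] isotropic, [u |-> u + t v] keeps [|u|^2] on the hyperplane orthogonal
   to [v], and off it hits the isotropic cone for exactly one [t]. *)
Lemma sum_isotropic_orthogonal n (v : 'rV[F]_n) : v != 0 -> dot v v = 0 ->
  \sum_(u : 'rV[F]_n) (dot u u == 0)%:R * (dot u v == 0)%:R
    = \sum_(u : 'rV[F]_n) (dot u u == 0)%:R - q ^+ n / q + q ^+ n / q ^+ 2 :> R.
Proof.
move=> v0 vv; set N := \sum_(u : 'rV[F]_n) (dot u u == 0)%:R : R.
have count1 : \sum_(t : F) \sum_(u : 'rV[F]_n) (dot (u + t *: v) (u + t *: v) == 0)%:R
    = q * N :> R.
  under eq_bigr => t _.
    rewrite -(reindex_inj (addIr (t *: v)) (P := xpredT) (F := fun u => (dot u u == 0)%:R : R)).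
    over.
  by rewrite sum_const.
have count2 (u : 'rV[F]_n) : \sum_(t : F) (dot (u + t *: v) (u + t *: v) == 0)%:R
    = 1 - (dot u v == 0)%:R + q * ((dot u u == 0)%:R * (dot u v == 0)%:R) :> R.
  have expand t : dot (u + t *: v) (u + t *: v) = dot u u + t * (dot u v *+ 2).
    by rewrite !dotE vv (dotC v u); ring.
  under eq_bigr => t _ do rewrite expand.
  have [uv|uv] := eqVneq (dot u v) 0.
    under eq_bigr do rewrite uv mul0rn mulr0 addr0.
    by rewrite sum_const subrr add0r mulr1.
  rewrite subr0 mulr0 mulr0 addr0.
  rewrite -[RHS](sum_eq_indicator R (- dot u u / (dot u v *+ 2))).
  apply: eq_bigr => t _; congr (GRing.natmul _ (nat_of_bool _)).
  have uv2 : dot u v *+ 2 != 0 by rewrite -mulr_natr mulf_neq0 // two_neq0.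
  by rewrite -[RHS](inj_eq (mulIf uv2)) divfK // eqr_oppLR addr_eq0.
move: count1; rewrite exchange_big (eq_bigr _ (fun u _ => count2 u)) /=.
rewrite big_split sumrB sum_const mulr1 card_mx mul1n natrX -mulr_sumr /=.
rewrite (sum_linear_eq 0 v0); set S := \sum_u _.
have := card_neq0r; set x := _%:R : R => x0 h.
have -> : N = (x ^+ n - x ^+ n / x + x * S) / x by rewrite h mulrC mulKf.
by field.
Qed.

(* Writing [w = u + t v] with [u] orthogonal to [v] and summing over [s], the
   equation [|w|^2 + |v|^2 s^2 = 0] becomes [s^2 + t^2 = - |u|^2 / |v|^2]. *)
Lemma sum_isotropic_orthogonal_aniso m (v : 'rV[F]_(m.*2)) : dot v v != 0 ->
  \sum_(u : 'rV[F]_(m.*2)) (dot u u == 0)%:R * (dot u v == 0)%:R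
    = q ^+ m.*2 / q ^+ 2 :> R.
Proof.
move=> vv; set S := \sum_u _.
pose T : R := \sum_(s : F) \sum_(w : 'rV[F]_(m.*2)) (dot w w + dot v v * s ^+ 2 == 0)%:R.
(* The deviation term of [sum_norm_eq] is a multiple of [[s = 0] - 1/q], which sums to zero over
   [s]. *)
have count1 : T = q ^+ m.*2.
  rewrite /T; under eq_bigr => s _.
    under eq_bigr => w _ do rewrite addr_eq0.
    rewrite sum_norm_eq oppr_eq0 mulf_eq0 (negPf vv) sqrf_eq0 /= (eq_sym s).
    over.
  rewrite big_split /= sum_const -mulr_sumr sumrB sum_eq_indicator sum_const /=.
  have := card_neq0r; set x := _%:R : R => x0.
  by move: (x ^+ m.*2) ((- x) ^+ m) => Q P; field.
have count2 : T = (q + 1) * (q ^+ m.*2 / q) - q * S.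
  have vn0 : v != 0 by apply: contraNneq vv => ->; rewrite dot0l.
  (* The term [q^(2m)/q] is read as the number of [u] orthogonal to [v], so that the right side
     becomes a sum of circle sizes over these [u]. *)
  rewrite -(sum_linear_eq 0 vn0) !mulr_sumr -sumrB.
  under [RHS]eq_bigr => u _.
    have -> : (q + 1) * (dot u v == 0)%:R - q * ((dot u u == 0)%:R * (dot u v == 0)%:R)
        = (dot u v == 0)%:R * \sum_(s : F) \sum_(t : F)
            (s ^+ 2 + t ^+ 2 == - dot u u / dot v v)%:R :> R.
      by rewrite sum_circle // mulf_eq0 invr_eq0 (negPf vv) orbF oppr_eq0; ring.
    rewrite mulr_sumr; under eq_bigr => s _ do rewrite mulr_sumr.
    over.
  rewrite exchange_big; apply: eq_bigr => s _ /=.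
  rewrite exchange_big /=.
  transitivity (\sum_(t : F) \sum_(w : 'rV[F]_(m.*2))
      (dot w v / dot v v == t)%:R * (dot w w + dot v v * s ^+ 2 == 0)%:R : R).
    rewrite exchange_big; apply: eq_bigr => w _ /=.
    by rewrite -mulr_suml sum_eq_indicator mul1r.
  apply: eq_bigr => t _; rewrite (reindex_inj (addIr (t *: v))) /=.
  apply: eq_bigr => u _; rewrite !dotE (dotC v u) mulrDl mulfK // -subr_eq0 addrK.
  rewrite mulf_eq0 invr_eq0 (negPf vv) orbF.
  have [uv|_] := eqVneq (dot u v) 0; last by rewrite !mul0r.
  rewrite uv !mul1r; congr (GRing.natmul _ (nat_of_bool _)).
  rewrite -[RHS](inj_eq (mulIf vv)) divfK // -[RHS]subr_eq0.
  by congr (_ == 0); ring.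
move: count2; rewrite count1.
have := card_neq0r; set x := _%:R : R => x0 h.
have -> : S = ((x + 1) * (x ^+ m.*2 / x) - x ^+ m.*2) / x.
  by rewrite [X in _ - X]h subKr mulrC mulKf.
by field.
Qed.

End IsotropicCounts.

(** * Incidences of a point set with hyperplanes *)

Section HyperplaneCounts.
Variables (R : realFieldType) (F : finFieldType) (n : nat) (B : {set 'rV[F]_n}).
Local Notation q := (#|F|%:R : R).
Local Notation V := 'rV[F]_n.

Definition hcount (u : V) (c : F) : R := \sum_(y in B) (dot u y == c)%:R.

Lemma sum_in_const (a : R) : \sum_(y in B) a = #|B|%:R * a.
Proof. by rewrite sumr_const mulr_natl. Qed.

(** The levels [c] partition [B], so the mean is [|B|/q]; the second moment counts pairs of [B] on a
    common level. *)
Lemma hcount_variance (u : V) :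
  \sum_c (hcount u c - #|B|%:R / q) ^+ 2
    = \sum_(y in B) \sum_(y' in B) (dot u (y - y') == 0)%:R - #|B|%:R ^+ 2 / q.
Proof.
have sum1 : \sum_c hcount u c = #|B|%:R.
  rewrite exchange_big /= (eq_bigr (fun=> 1)) => [|y _]; last exact: sum_eq_indicator.
  by rewrite sum_in_const mulr1.
have sum2 : \sum_c hcount u c ^+ 2
    = \sum_(y in B) \sum_(y' in B) (dot u (y - y') == 0)%:R.
  under eq_bigr => c _ do rewrite expr2 /hcount mulr_suml.
  rewrite exchange_big; apply: eq_bigr => y _ /=.
  by rewrite sum_indicator; apply: eq_bigr => y' _; rewrite !dotE subr_eq0 eq_sym.
have -> : \sum_c (hcount u c - #|B|%:R / q) ^+ 2
    = \sum_c (hcount u c ^+ 2 - (2 * #|B|%:R / q) * hcount u c + (#|B|%:R / q) ^+ 2).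
  by apply: eq_bigr => c _; ring.
rewrite big_split sumrB -mulr_sumr sum1 sum2 sum_const /=.
by have := card_neq0r R F; move: (#|F|%:R : R) => x x0; field.
Qed.

Lemma sum_diff_eq0 : \sum_(y in B) \sum_(y' in B) (y - y' == 0)%:R = #|B|%:R :> R.
Proof.
rewrite -[RHS]mulr1 -sum_in_const; apply: eq_bigr => y yB.
rewrite (bigD1 y) //= subrr eqxx big1 ?addr0 // => y' /andP [_ yy'].
by rewrite subr_eq0 eq_sym (negPf yy').
Qed.

(** Each nonzero difference [y - y'] is orthogonal to exactly [q^n/q] vectors, which cancels the
    squared mean; only the diagonal pairs leave a contribution. *)
Lemma hcount_total_variance :
  \sum_u \sum_c (hcount u c - #|B|%:R / q) ^+ 2
    = #|B|%:R * (q ^+ n - q ^+ n / q).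
Proof.
under eq_bigr => u _ do rewrite hcount_variance.
rewrite sumrB exchange_big /= sum_const card_mx mul1n natrX.
have orth (v : V) : \sum_u (dot u v == 0)%:R
    = q ^+ n / q + (q ^+ n - q ^+ n / q) * (v == 0)%:R :> R.
  have [->|v0] := eqVneq v 0; last by rewrite (sum_linear_eq R 0 v0) mulr0 addr0.
  under eq_bigr do rewrite dot0r eqxx.
  by rewrite sum_const card_mx mul1n natrX !mulr1 addrC subrK.
under eq_bigr => y _.
  rewrite exchange_big /=; under eq_bigr => y' _ do rewrite orth.
  rewrite big_split /= sum_in_const -mulr_sumr.
  over.
rewrite big_split /= sum_in_const -mulr_sumr sum_diff_eq0.
by have := card_neq0r R F; move: (#|F|%:R : R) => x x0; field.
Qed.

(** Here [p] holds a scalar and the vertex [z] of the angle; the normal is the scalar times the leg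
    [x - z]. *)
Definition dilation_weight (x : V) (p : F * V) : bool :=
  [&& p.1 != 0, p.2 \in B & dot (x - p.2) (x - p.2) != 0].

(* A hyperplane is counted once for each of its [q - 1] normals [u], whence the
   scalar [p.1]. *)
Definition gcount (u : V) (c : F) : R := \sum_(x in B) \sum_(p : F * V)
  (dilation_weight x p)%:R * ((p.1 *: (x - p.2) == u)%:R * (dot u p.2 == c)%:R).

Lemma sum_gcount (f : V -> F -> R) :
  \sum_u \sum_c gcount u c * f u c
    = \sum_(x in B) \sum_(p : F * V) (dilation_weight x p)%:R *
        f (p.1 *: (x - p.2)) (dot (p.1 *: (x - p.2)) p.2).
Proof.
under eq_bigr => u _.
  under eq_bigr => c _.
    rewrite /gcount mulr_suml; under eq_bigr => x _ do rewrite mulr_suml.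
    over.
  rewrite exchange_big; under eq_bigr => x _ do rewrite exchange_big.
  over.
rewrite exchange_big; apply: eq_bigr => x _ /=.
rewrite exchange_big; apply: eq_bigr => p _ /=.
rewrite -[in RHS](sum_indicator _ (fun u => f u (dot u p.2))) mulr_sumr.
apply: eq_bigr => u _; rewrite -[in RHS](sum_indicator (dot u p.2) (f u)) !mulr_sumr.
by apply: eq_bigr => c _; ring.
Qed.

(* Given the hyperplane [u . z = c], the point [z] is the foot of the
   perpendicular from [x], so [x] determines the rest. *)
Lemma gcount_le u c : gcount u c <= #|B|%:R.
Proof.
rewrite -[leRHS]mulr1 -sum_in_const; apply: ler_sum => x _.
under eq_bigr => p _ do rewrite -!natrM !mulnb.
apply: sum_indicator_le1 => -[l z] [l' z'] /=.
move=> /and3P [/and3P /= [l0 _ vv] /eqP lu /eqP zc].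
move=> /and3P [/and3P /= [l0' _ vv'] /eqP lu' /eqP zc'].
(* Since [u . u] is nonzero, this identity determines the scalar [l] from [u], [c] and [x]; then
   [u = l (x - z)] determines [z]. *)
have e : dot u u = l * (dot u x - c) by rewrite -zc -{2}lu !dotE; ring.
have e' : dot u u = l' * (dot u x - c) by rewrite -zc' -{2}lu' !dotE; ring.
have uu : dot u u != 0 by rewrite -lu dotZl dotZr !mulf_neq0.
have k0 : dot u x - c != 0 by apply: contraNneq uu => k0; rewrite e k0 mulr0.
have ll : l = l' by apply: (mulIf k0); rewrite -e -e'.
congr pair => //; move: lu'; rewrite -lu -ll => /(scalerI l0) /addrI /oppr_inj.
by [].
Qed.

Lemma gcount_ge0 u c : 0 <= gcount u c.
Proof. by apply: sumr_ge0 => x _; apply: sumr_ge0 => p _; rewrite !mulr_ge0. Qed.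

Lemma sum_dilation_weight (f : V -> V -> R) :
  \sum_(x in B) \sum_(p : F * V) (dilation_weight x p)%:R * f x p.2
   = (q - 1) * \sum_(x in B) \sum_(z in B) (dot (x - z) (x - z) != 0)%:R * f x z.
Proof.
rewrite mulr_sumr; apply: eq_bigr => x _.
rewrite -(pair_bigA _ (fun l z => (dilation_weight x (l, z))%:R * f x z)) /=.
have -> : q - 1 = \sum_(l : F) (l != 0)%:R.
  rewrite (bigD1 0) //= eqxx add0r (eq_bigr (fun=> 1)) => [|l ->] //.
  by rewrite sumr_const cardC1 -subn1 natrB // ltnW // finNzRing_gt1.
rewrite mulr_suml; apply: eq_bigr => l _; rewrite mulr_sumr [RHS]big_mkcond /=.
apply: eq_bigr => z _; rewrite /dilation_weight /=.
by case: (l != 0); case: (z \in B) => /=; rewrite ?mul0r ?mul1r.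
Qed.

(** Here [s] is [q^((n-1)/2)]. The triples, taken [q - 1] times, are the sum of [gcount * hcount].
    Replacing [hcount] by its mean gives the cubic term; the deviation gives the quadratic one. *)
Lemma right_angles_aniso_leg (s : R) : 0 < s -> s ^+ 2 = q ^+ n / q ->
  \sum_(x in B) \sum_(z in B) (dot (x - z) (x - z) != 0)%:R *
     (\sum_(y in B) (dot (x - z) (y - z) == 0)%:R)
  <= #|B|%:R ^+ 3 / q + s * #|B|%:R ^+ 2.
Proof.
move=> s0 s2; set T := \sum_(x in B) _.
have q1 : 0 < q - 1 by rewrite subr_gt0 ltr1n finNzRing_gt1.
have q0 := card_neq0r R F; have qp := card_gt0r R F.
have sumGh : \sum_u \sum_c gcount u c * hcount u c = (q - 1) * T.
  rewrite sum_gcount -sum_dilation_weight.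
  apply: eq_bigr => x _; apply: eq_bigr => -[l z] _ /=.
  case w : (dilation_weight x (l, z)); last by rewrite !mul0r.
  congr (_ * _); apply: eq_bigr => y _; case/and3P: w => /= l0 _ _.
  rewrite -subr_eq0 !dotZl -mulrBr mulf_eq0 (negPf l0) /=.
  by congr (GRing.natmul _ (nat_of_bool (_ == _))); rewrite !dotE; ring.
have sumG : \sum_u \sum_c gcount u c <= (q - 1) * #|B|%:R ^+ 2.
  under eq_bigr => u _ do under eq_bigr => c _ do rewrite -[gcount u c]mulr1.
  rewrite (sum_gcount (fun _ _ => 1)) (sum_dilation_weight (fun _ _ => 1)).
  rewrite ler_wpM2l ?(ltW q1) // expr2 -sum_in_const; apply: ler_sum => x _.
  rewrite -[leRHS]mulr1 -sum_in_const; apply: ler_sum => z _.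
  by rewrite mulr1 lern1 leq_b1.
(* The empty set is treated apart because a factor [|B|] is cancelled below. *)
have [B0|B0] := eqVneq #|B| 0%N.
  have -> : T = 0 by rewrite /T (cards0_eq B0) big_set0.
  by rewrite B0 !expr0n /= mul0r mulr0 addr0.
set b : R := #|B|%:R; have b0 : 0 < b by rewrite ltr0n lt0n.
(* Cauchy-Schwarz in the form [2 s b g h <= s^2 g^2 + b^2 h^2], with [g^2 <= b g]. The weights [s]
   and [b] make the final bounds on both sums equal to [(q - 1) s^2 b^3]. *)
have amgm : 2 * s * b * (\sum_u \sum_c gcount u c * (hcount u c - b / q))
   <= s ^+ 2 * b * (\sum_u \sum_c gcount u c)
     + b ^+ 2 * (\sum_u \sum_c (hcount u c - b / q) ^+ 2).
  rewrite !mulr_sumr -big_split; apply: ler_sum => u _ /=.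
  rewrite !mulr_sumr -big_split; apply: ler_sum => c _ /=.
  have := gcount_le u c; have := gcount_ge0 u c; rewrite -/b.
  move: (gcount u c) (hcount u c - b / q) => g h g0 gb.
  have : 0 <= (s * g - b * h) ^+ 2 by exact: sqr_ge0.
  have : s ^+ 2 * (g * g) <= s ^+ 2 * (b * g) by rewrite ler_wpM2l ?sqr_ge0 // ler_wpM2r.
  by nra.
move: amgm; rewrite hcount_total_variance -/b.
have -> : \sum_u \sum_c gcount u c * (hcount u c - b / q)
    = (q - 1) * T - b / q * \sum_u \sum_c gcount u c.
  rewrite -sumGh mulr_sumr -sumrB; apply: eq_bigr => u _.
  by rewrite mulr_sumr -sumrB; apply: eq_bigr => c _; ring.
move: sumG; rewrite -/b; set M := \sum_u \sum_c _ => sumG.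
have -> : q ^+ n - q ^+ n / q = (q - 1) * s ^+ 2 by rewrite s2; field.
move=> h; have {}h : 2 * s * b * ((q - 1) * T - b / q * M) <= 2 * s * b * ((q - 1) * s * b ^+ 2).
  have : s ^+ 2 * b * M <= s ^+ 2 * b * ((q - 1) * b ^+ 2).
    by rewrite ler_wpM2l // mulr_ge0 ?sqr_ge0 // ltW.
  by move=> h1; apply: (le_trans h); nra.
have sb : 0 < 2 * s * b by rewrite !mulr_gt0.
rewrite ler_pM2l // in h.
rewrite -(ler_pM2l q1); have h2 : b / q * M <= b / q * ((q - 1) * b ^+ 2).
  by rewrite ler_wpM2l // divr_ge0 // ltW.
have -> : (q - 1) * (b ^+ 3 / q + s * b ^+ 2) = (q - 1) * s * b ^+ 2 + b / q * ((q - 1) * b ^+ 2).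
  by field.
by lra.
Qed.

End HyperplaneCounts.

(** * Pairs at distance zero and right angles *)

Section Triples.
Variables (R : realFieldType) (F : finFieldType).
Hypothesis q3 : (#|F| %% 4 = 3)%N.
Local Notation q := (#|F|%:R : R).

(* Summing the variances [hcount_variance] over the isotropic [u] gives a
   nonnegative quantity in which, [m] being odd, the pairs at distance zero
   have a negative coefficient. *)
Lemma zero_distance_pairs m (B : {set 'rV[F]_(m.*2)}) : odd m ->
  \sum_(y in B) \sum_(y' in B) (dot (y - y') (y - y') == 0)%:R
    <= #|B|%:R ^+ 2 / q + q ^+ m / q * #|B|%:R :> R.
Proof.
move=> modd; set Z := \sum_(y in B) _; set b : R := #|B|%:R.
have q1 : 0 < q - 1 by rewrite subr_gt0 ltr1n finNzRing_gt1.
have q0 := card_neq0r R F; have qp := card_gt0r R F.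
pose N : R := \sum_(u : 'rV[F]_(m.*2)) (dot u u == 0)%:R.
set P := q ^+ m; have P0 : 0 < P by rewrite exprn_gt0.
have P2 : q ^+ m.*2 = P ^+ 2 by rewrite -muln2 exprM.
have eN : N = P ^+ 2 / q - P * (1 - q^-1).
  rewrite /N sum_norm_eq // eqxx P2 exprNn -signr_odd modd expr1 mulN1r -/P.
  by rewrite mulNr.
(* One formula for [v] zero, isotropic or anisotropic; the isotropic [v] have a smaller count than
   the anisotropic ones because [m] is odd. *)
have orth (v : 'rV[F]_(m.*2)) :
  \sum_(u : 'rV[F]_(m.*2)) (dot u u == 0)%:R * (dot u v == 0)%:R
   = P ^+ 2 / q ^+ 2 - P * (1 - q^-1) * (dot v v == 0)%:R
     + (P ^+ 2 / q - P ^+ 2 / q ^+ 2) * (v == 0)%:R.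
  have [->|v0] := eqVneq v 0.
    under eq_bigr do rewrite dot0r eqxx mulr1.
    by rewrite -/N eN dot0l eqxx !mulr1; field.
  have [vv|vv] := eqVneq (dot v v) 0.
    by rewrite (sum_isotropic_orthogonal R q3 v0 vv) -/N eN P2 mulr1 mulr0; field.
  by rewrite (sum_isotropic_orthogonal_aniso R q3 vv) P2 !mulr0 subr0 addr0.
have : 0 <= \sum_(u : 'rV[F]_(m.*2)) (dot u u == 0)%:R
    * \sum_c (hcount R B u c - b / q) ^+ 2.
  apply: sumr_ge0 => u _; rewrite mulr_ge0 //.
  by apply: sumr_ge0 => c _; exact: sqr_ge0.
under eq_bigr => u _.
  rewrite hcount_variance mulrBr mulr_sumr.
  under eq_bigr => y _ do rewrite mulr_sumr.
  over.
rewrite sumrB -mulr_suml -/N -/b exchange_big /=.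
under eq_bigr => y _.
  rewrite exchange_big /=; under eq_bigr => y' _ do rewrite orth.
  rewrite big_split sumrB /= sum_in_const -!mulr_sumr.
  over.
rewrite big_split sumrB /= sum_in_const -!mulr_sumr -/Z sum_diff_eq0 -/b eN => h.
have k0 : 0 < P * (1 - q^-1) by rewrite mulr_gt0 // subr_gt0 invf_lt1 // -subr_gt0.
(* The nonnegative sum of variances equals [P (1 - 1/q)] times the right side minus the left
   side. *)
rewrite -(ler_pM2l k0) -subr_ge0; apply: (le_trans h); rewrite le_eqVlt; apply/orP; left.
by apply/eqP; field.
Qed.

(** For each [z] the pair bound is applied to [Bz], and [|Bz| <= |B|]; summing over [z] costs one
    more factor [|B|]. *)
Lemma zero_distance_triangles m (B : {set 'rV[F]_(m.*2)}) : odd m ->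
  \sum_(z in B) \sum_(x in B) \sum_(y in B)
    (dot (x - z) (x - z) == 0)%:R * (dot (y - z) (y - z) == 0)%:R
      * (dot (x - y) (x - y) == 0)%:R
  <= #|B|%:R ^+ 3 / q + q ^+ m / q * #|B|%:R ^+ 2 :> R.
Proof.
move=> modd; have qp := card_gt0r R F.
have -> : #|B|%:R ^+ 3 / q + q ^+ m / q * #|B|%:R ^+ 2
    = #|B|%:R * (#|B|%:R ^+ 2 / q + q ^+ m / q * #|B|%:R) :> R by ring.
rewrite -sum_in_const; apply: ler_sum => z _.
pose Bz := [set x in B | dot (x - z) (x - z) == 0].
have -> : \sum_(x in B) \sum_(y in B)
    (dot (x - z) (x - z) == 0)%:R * (dot (y - z) (y - z) == 0)%:R
      * (dot (x - y) (x - y) == 0)%:R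
   = \sum_(x in Bz) \sum_(y in Bz) (dot (x - y) (x - y) == 0)%:R :> R.
  have restrict (f : 'rV[F]_(m.*2) -> R) :
      \sum_(x in Bz) f x = \sum_(x in B) (dot (x - z) (x - z) == 0)%:R * f x.
    rewrite [LHS]big_mkcond [RHS]big_mkcond; apply: eq_bigr => x _ /=.
    by rewrite inE; case: (x \in B) => //=; case: ifP => _; rewrite ?mul1r ?mul0r.
  rewrite restrict; apply: eq_bigr => x _; rewrite restrict mulr_sumr.
  by apply: eq_bigr => y _; rewrite mulrA.
apply: le_trans (zero_distance_pairs Bz modd) _.
have BzB : #|Bz|%:R <= #|B|%:R :> R.
  by rewrite ler_nat subset_leq_card //; apply/subsetP => x; rewrite inE => /andP [].
apply: lerD; first by rewrite ler_wpM2r ?invr_ge0 ?(ltW qp) // ler_pXn2r // nnegrE.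
by rewrite ler_wpM2l // divr_ge0 ?exprn_ge0 // ltW.
Qed.

(** Every right angle has its first leg anisotropic, or its second, or both isotropic. The three
    bounds add up, angles with two anisotropic legs being counted twice. *)
Lemma right_angles m (B : {set 'rV[F]_(m.*2)}) (s : R) :
  odd m -> 0 < s -> s ^+ 2 = q ^+ m.*2 / q ->
  \sum_(z in B) \sum_(x in B) \sum_(y in B) (dot (x - z) (y - z) == 0)%:R
  <= 3 * (#|B|%:R ^+ 3 / q) + (2 * s + q ^+ m / q) * #|B|%:R ^+ 2.
Proof.
move=> modd s0 s2.
have aniso := right_angles_aniso_leg B s0 s2.
have iso := zero_distance_triangles B modd.
have leg : \sum_(z in B) \sum_(x in B) \sum_(y in B)
     (dot (x - z) (x - z) != 0)%:R * (dot (x - z) (y - z) == 0)%:R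
   <= #|B|%:R ^+ 3 / q + s * #|B|%:R ^+ 2.
  rewrite exchange_big /=; apply: le_trans aniso; apply: ler_sum => x _.
  by apply: ler_sum => z _; rewrite mulr_sumr.
have leg' : \sum_(z in B) \sum_(x in B) \sum_(y in B)
     (dot (y - z) (y - z) != 0)%:R * (dot (x - z) (y - z) == 0)%:R
   <= #|B|%:R ^+ 3 / q + s * #|B|%:R ^+ 2.
  apply: le_trans leg; apply: ler_sum => z _; rewrite exchange_big /=.
  by apply: ler_sum => x _; apply: ler_sum => y _; rewrite dotC.
apply: le_trans (_ : _ <= (#|B|%:R ^+ 3 / q + s * #|B|%:R ^+ 2)
   + (#|B|%:R ^+ 3 / q + s * #|B|%:R ^+ 2)
   + (#|B|%:R ^+ 3 / q + q ^+ m / q * #|B|%:R ^+ 2)) _; last by lra.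
apply: le_trans (lerD (lerD leg leg') iso).
rewrite -!big_split; apply: ler_sum => z _ /=.
rewrite -!big_split; apply: ler_sum => x _ /=.
rewrite -!big_split; apply: ler_sum => y _ /=.
have [xyz|_] := eqVneq (dot (x - z) (y - z)) 0; last first.
  by rewrite !addr_ge0 // !mulr_ge0.
have [xz|xz] /= := eqVneq (dot (x - z) (x - z)) 0; last first.
  by rewrite !mulr1 -addrA lerDl addr_ge0 // !mulr_ge0.
have [yz|yz] /= := eqVneq (dot (y - z) (y - z)) 0; last first.
  by rewrite !(mul0r, mulr0, add0r, addr0, mul1r).
(* With both legs isotropic and orthogonal, [x - y] is isotropic as their difference. *)
have -> : x - y = (x - z) - (y - z) by rewrite opprB addrA subrK.
move: (x - z) (y - z) xyz xz yz => u w uw uu ww.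
by rewrite !dotE (dotC w u) uw uu ww !(oppr0, addr0, add0r) eqxx !mul0r !add0r !mulr1.
Qed.

End Triples.

(** * From additive energy on the paraboloid to right angles *)

Section Energy.
Variables (F : finFieldType) (n : nat).
Hypothesis q3 : (#|F| %% 4 = 3)%N.

Definition base_point (x : 'rV[F]_n.+1) : 'rV[F]_n :=
  \row_i x 0 (widen_ord (leqnSn n) i).

Lemma base_pointD x y : base_point (x + y) = base_point x + base_point y.
Proof. by apply/rowP => i; rewrite !mxE. Qed.

Lemma mem_paraboloid x :
  (x \in paraboloid F n) = (x 0 ord_max == dot (base_point x) (base_point x)).
Proof.
by rewrite inE /dot; congr (_ == _); apply: eq_bigr => i _; rewrite !mxE expr2.
Qed.

Lemma base_point_inj : {in paraboloid F n &, injective base_point}.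
Proof.
move=> x y; rewrite !mem_paraboloid => /eqP hx /eqP hy exy.
apply/rowP => i; case: (unliftP ord_max i) => [j|] ->; last by rewrite hx hy exy.
have := congr1 (fun v : 'rV_n => v 0 j) exy; rewrite !mxE.
by rewrite (_ : widen_ord _ _ = lift ord_max j) //; apply: val_inj; rewrite /= /bump leqNgt ltn_ord.
Qed.

(** With base points [x, y, z] of [a, b, c], that of [e] is [x + y - z]. The last coordinates give
    [|x|^2 + |y|^2 = |z|^2 + |x + y - z|^2], that is [2 (x - z).(y - z) = 0]. *)
Lemma paraboloid_rectangle a b c e :
  a \in paraboloid F n -> b \in paraboloid F n ->
  c \in paraboloid F n -> e \in paraboloid F n -> a + b = c + e ->
  dot (base_point a - base_point c) (base_point b - base_point c) = 0.
Proof.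
rewrite !mem_paraboloid => /eqP ha /eqP hb /eqP hc /eqP he abce.
have hlast : a 0 ord_max + b 0 ord_max = c 0 ord_max + e 0 ord_max.
  by have := congr1 (fun v : 'rV_n.+1 => v 0 ord_max) abce; rewrite !mxE.
have hbase : base_point e = base_point a + base_point b - base_point c.
  by rewrite -base_pointD abce base_pointD addrC addKr.
move: hlast; rewrite ha hb hc he hbase.
move: (base_point a) (base_point b) (base_point c) => x y z h.
have : 2%:R * dot (x - z) (y - z) = 0.
  move/eqP: h; rewrite -subr_eq0 => /eqP h; rewrite -[RHS]oppr0 -[in RHS]h !dotE.
  by rewrite (dotC y x) (dotC z x) (dotC z y); ring.
by move/eqP; rewrite mulf_eq0 (negPf (two_neq0 q3)) => /eqP.
Qed.

Lemma add_energy_le_right_angles (R : numDomainType) (A : {set 'rV[F]_n.+1}) :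
  A \subset paraboloid F n ->
  (add_energy A)%:R <= \sum_(z in base_point @: A) \sum_(x in base_point @: A)
    \sum_(y in base_point @: A) (dot (x - z) (y - z) == 0)%:R :> R.
Proof.
move=> /subsetP AP; set B := base_point @: A.
pose g (t : 'rV[F]_n.+1 * 'rV[F]_n.+1 * 'rV[F]_n.+1 * 'rV[F]_n.+1) :=
  (base_point t.1.2, (base_point t.1.1.1, base_point t.1.1.2)).
rewrite /add_energy; set E := [set t | _].
(* The points [a, b, c] are recovered from their base points, and [e = a + b - c]. *)
have ginj : {in E &, injective g}.
  move=> [[[a b] c] e] [[[a' b'] c'] e']; rewrite !inE /g /=.
  move=> /and5P [ha hb hc he /eqP s] /and5P [ha' hb' hc' he' /eqP s'] [cc aa bb].
  have {}aa := base_point_inj (AP _ ha) (AP _ ha') aa.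
  have {}bb := base_point_inj (AP _ hb) (AP _ hb') bb.
  have {}cc := base_point_inj (AP _ hc) (AP _ hc') cc.
  by move: s'; rewrite -aa -bb -cc s => /addrI ->.
rewrite -(card_in_imset ginj).
have -> : \sum_(z in B) \sum_(x in B) \sum_(y in B) (dot (x - z) (y - z) == 0)%:R
    = #|[set t : 'rV[F]_n * ('rV[F]_n * 'rV[F]_n) | [&& t.1 \in B, t.2.1 \in B,
         t.2.2 \in B & dot (t.2.1 - t.1) (t.2.2 - t.1) == 0]]|%:R :> R.
  under eq_bigr do rewrite pair_big /=.
  rewrite pair_big /= -sum1_card natr_sum [LHS]big_mkcond [RHS]big_mkcond.
  apply: eq_bigr => -[z [x y]] _; rewrite inE /=.
  by case: (z \in B); case: (x \in B); case: (y \in B) => //=; case: (_ == _).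
rewrite ler_nat subset_leq_card //; apply/subsetP => _ /imsetP [[[[a b] c] e] + ->].
rewrite !inE /= => /and5P [ha hb hc he /eqP s]; rewrite !imset_f //=.
by apply/eqP; apply: paraboloid_rectangle s; apply: AP.
Qed.

End Energy.

(* d = 4k+3 = (4k+2).+1 ; q = #|F| ; q^((d-2)/2) = q^(2k) * sqrt q. *)
Theorem theorem2p1 (R : realType) :
  exists C : R,
  forall (F : finFieldType), (#|F| %% 4 = 3)%N ->
  forall (k : nat), (0 < k)%N ->
  forall A : {set 'rV[F]_(4 * k + 2).+1},
    A \subset paraboloid F (4 * k + 2) ->
    (add_energy A)%:R <=
      C * ((#|A|%:R ^+ 3) / #|F|%:R
           + (#|F|%:R ^+ (2 * k) * Num.sqrt (#|F|%:R)) * #|A|%:R ^+ 2).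
Proof.
(* With [s = q^(2k) sqrt q] and [m = 2k + 1], the quadratic coefficient is [2 s + q^(2k) <= 3 s],
   and the cubic one is already 3. *)
exists 3 => F q3 k _ A AP; apply: le_trans (add_energy_le_right_angles q3 R AP) _.
rewrite -(card_in_imset (sub_in2 (subsetP AP) (base_point_inj (F := F) (n := 4 * k + 2)))).
have dim : (4 * k + 2 = ((2 * k).+1).*2)%N by lia.
move: (@base_point F _ @: A); rewrite dim => B.
have q0 : 0 < #|F|%:R :> R := card_gt0r R F.
set q : R := #|F|%:R; have q0' : q != 0 by rewrite gt_eqF.
have r2 : Num.sqrt q ^+ 2 = q by rewrite sqr_sqrtr // ltW.
have r1 : 1 <= Num.sqrt q by rewrite -sqrtr1 ler_wsqrtr // ler1n -(ltr0n R).
have s0 : 0 < q ^+ (2 * k) * Num.sqrt q by rewrite mulr_gt0 ?exprn_gt0 // sqrtr_gt0.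
have modd : odd (2 * k).+1 by rewrite /= mul2n odd_double.
have s2 : (q ^+ (2 * k) * Num.sqrt q) ^+ 2 = q ^+ (2 * k).+1.*2 / q.
  by rewrite exprMn r2 -exprM muln2 doubleS !exprS mulrC [RHS]mulrC mulKf.
apply: le_trans (right_angles q3 B modd s0 s2) _.
rewrite -/q [leRHS]mulrDr lerD2l [leRHS]mulrA ler_wpM2r ?exprn_ge0 //.
rewrite exprS [q * _]mulrC mulfK //.
have : q ^+ (2 * k) * 1 <= q ^+ (2 * k) * Num.sqrt q by rewrite ler_wpM2l // exprn_ge0 // ltW.
by lra.
Qed.
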